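(* Let $\Delta, L_1$ and $\epsilon$ be positive, and let $\sigma=\frac{\epsilon^2}{3\Delta}$. Then the algorithm $\mathsf{PAGD}_{\sigma,L_1}\in\mathcal{A}_{\mathrm{det}}^{(1)}$ satisfies $$ \mathcal{T}_\epsilon\big(\mathcal{A}_{\mathrm{det}}^{(1)},\mathcal{F}^{\mathrm{conv}}(\Delta,L_1)\big)\ \le\ \sup_{f\in\mathcal{F}^{\mathrm{conv}}(\Delta,L_1)}\mathsf{T}_\epsilon\big(\mathsf{PAGD}_{\sigma,L_1},f\big)\ \le\ 1+5\,\frac{\sqrt{L_1\Delta}}{\epsilon}\,\log_+\!\left(\frac{25L_1\Delta}{\epsilon^2}\right). $$
   Context: Here $\mathbb{N}=\{1,2,\ldots\}$, $\|\cdot\|$ is the Euclidean norm, and $\log_+(x)=\max\{0,\log x\}$. Function class. $\mathcal{F}^{\mathrm{conv}}(\Delta,L_1)$ is the union, over $d\in\mathbb{N}$, of the collections of $\mathcal{C}^\infty$ convex functions $f:\mathbb{R}^d\to\mathbb{R}$ with $L_1$-Lipschitz gradient and $f(0)-\inf_x f(x)\le\Delta$. A function $f$ is $\sigma$-strongly convex if $f(y)\ge f(x)+\langle\nabla f(x),y-x\rangle+\frac{\sigma}{2}\|y-x\|^2$ for all $x,y$. Algorithms. An algorithm $\mathsf{A}$ maps (separately for every dimension $d$) functions $f:\mathbb{R}^d\to\mathbb{R}$ to sequences of iterates $\mathsf{A}[f]=\{x^{(t)}\}_{t\in\mathbb{N}}$ in $\mathbb{R}^d$. $\mathcal{A}_{\mathrm{det}}^{(1)}$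 (first-order deterministic algorithms) is the set of algorithms whose iterates have the form $x^{(i)}=\mathsf{A}^{(i)}\big(f(x^{(1)}),\nabla f(x^{(1)}),\ldots,f(x^{(i-1)}),\nabla f(x^{(i-1)})\big)$ for all $i\in\mathbb{N}$, with $\mathsf{A}^{(i)}$ a measurable mapping into $\mathbb{R}^d$ (depending on $d$ but not otherwise on $f$). $\mathcal{A}_{\mathrm{zr}}^{(1)}$ (first-order zero-respecting algorithms) is the set of algorithms such that for every $f$ the iterates satisfy $\mathrm{supp}(x^{(t)})\subseteq\bigcup_{s<t}\mathrm{supp}(\nabla f(x^{(s)}))$ for each $t\in\mathbb{N}$, where $\mathrm{supp}(v)=\{i:v_i\neq0\}$. Accelerated gradient descent. $\mathsf{AGD}_{\sigma,L}\in\mathcal{A}_{\mathrm{zr}}^{(1)}\cap\mathcal{A}_{\mathrm{det}}^{(1)}$ denotes Nesterov's accelerated gradient scheme for $\sigma$-strongly convex functions with $L$-Lipschitz gradient, initialized at $x^{(1)}=0$ (the exact step size scheme is not important). The known guarantee for it is: for any $\sigma$-strongly convex $f$ with $L$-Lipschitz gradient and (unique) global minimizer $x_f^\star$, the iterates $\{x^{(t)}\}=\mathsf{AGD}_{\sigma,L}[f]$ satisfy $$f(x^{(t)})-f(x_f^\star)\le(1-\sqrt{\sigma/L})^{t-1}L\|x_f^\star\|^2\quad\text{and}\quad f(x^{(t)})\le f(0)\quad\text{for every }t\in\mathbb{N}.$$ The proximal version is defined by $\mathsf{PAGD}_{\sigma,L_1}[f]=\mathsf{AGD}_{\sigma,L_1+\sigma}\big[f(\cdot)+\frac{\sigma}{2}\|\cdot\|^2\big]$.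 Complexity. $\mathsf{T}_\epsilon(\mathsf{A},f)=\inf\{t\in\mathbb{N}: \|\nabla f(x^{(t)})\|\le\epsilon\}$ where $\{x^{(t)}\}=\mathsf{A}[f]$, and for an algorithm class $\mathcal{A}$ and function class $\mathcal{F}$, $\mathcal{T}_\epsilon(\mathcal{A},\mathcal{F})=\inf_{\mathsf{A}\in\mathcal{A}}\sup_{f\in\mathcal{F}}\mathsf{T}_\epsilon(\mathsf{A},f)$. *)

(* Defs.v *)
From mathcomp Require Import all_boot all_order all_algebra.
From mathcomp Require Import all_classical all_reals all_analysis.

Set Implicit Arguments.
Unset Strict Implicit.
Unset Printing Implicit Defensive.
Import Order.TTheory GRing.Theory Num.Theory.
Import numFieldNormedType.Exports.

Local Open Scope classical_set_scope.
Local Open Scope ring_scope.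

(* Points of R^d, d >= 1, are row vectors 'rV[R]_d.+1: everywhere below the
   index d stands for the dimension minus one. *)

Section euclidean.
Context {R : realType} {d : nat}.
Implicit Types (u v x : 'rV[R]_d.+1) (f : 'rV[R]_d.+1 -> R).

Definition dot u v : R := \sum_j u 0 j * v 0 j.

(* The library norm `|v| on row vectors is the sup norm. *)
Definition enorm v : R := Num.sqrt (dot v v).

Definition supp v : set 'I_d.+1 := [set j | v 0 j != 0].

Definition grad f x : 'rV[R]_d.+1 := \row_j 'D_(delta_mx 0 j) f x.

Fixpoint class_C (k : nat) f : Prop :=
  if k is k'.+1 then
    (forall x, differentiable f x) /\
    (forall j, class_C k' (fun x => 'D_(delta_mx 0 j) f x))
  else continuous f.

Definition smooth f := forall k, class_C k f.

Definition lipschitz_gradient (L : R) f :=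
  (forall x, differentiable f x) /\
  (forall x y, enorm (grad f x - grad f y) <= L * enorm (x - y)).

Definition strongly_convex (sigma : R) f :=
  forall x y,
    f x + dot (grad f x) (y - x) + sigma / 2 * enorm (y - x) ^+ 2 <= f y.

End euclidean.

Definition function_class (R : realType) :=
  forall d : nat, set ('rV[R]_d.+1 -> R).

(* The infimum of f is taken in \bar R, so that the last condition forces f to
   be bounded below. *)
Definition F_conv {R : realType} (Delta L1 : R) : function_class R :=
  fun d => [set f | [/\ smooth f, convex_function setT f,
    lipschitz_gradient L1 f &
    ((f 0%R)%:E - ereal_inf (range (EFin \o f)) <= Delta%:E)%E]].

(* A d f t is the t-th iterate of A on f. Iterates are numbered from 1; the
   value at t = 0 is irrelevant. *)
Definition algorithm (R : realType) :=
  forall d : nat, ('rV[R]_d.+1 -> R) -> nat -> 'rV[R]_d.+1.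

(* R^d with its product sigma-algebra, generated by the cylinders
   {v | v_j \in B} with B Borel. *)
Definition cylinders (R : realType) (d : nat) : set (set 'rV[R]_d.+1) :=
  [set A | exists (j : 'I_d.+1) (B : set (measurableTypeR R)),
    measurable B /\ A = [set v : 'rV[R]_d.+1 | B (v 0 j)]].

Definition borel_rV (R : realType) (d : nat) :=
  g_sigma_algebraType (@cylinders R d).

Notation oracle_answer R d := (measurableTypeR R * borel_rV R d)%type.

(* The answers obtained at the first t iterates x 1, ..., x t. *)
Definition history {R : realType} {d : nat} (f : 'rV[R]_d.+1 -> R)
    (x : nat -> 'rV[R]_d.+1) (t : nat) : t.-tuple (oracle_answer R d) :=
  [tuple (f (x s.+1), grad f (x s.+1)) | s < t].

(* A first-order algorithm is only constrained on functions which have a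
   gradient: elsewhere grad f consists of default values. The map Ai t, which
   reads t answers, produces the iterate number t.+1. *)
Definition A_det {R : realType} : set (algorithm R) :=
  [set A | forall d : nat,
    exists Ai : forall t : nat, t.-tuple (oracle_answer R d) -> borel_rV R d,
      (forall t, measurable_fun setT (Ai t)) /\
      (forall f : 'rV[R]_d.+1 -> R, (forall x, differentiable f x) ->
         forall t : nat, A d f t.+1 = Ai t (history f (A d f) t))].

Definition A_zr {R : realType} : set (algorithm R) :=
  [set A | forall (d : nat) (f : 'rV[R]_d.+1 -> R),
    (forall x, differentiable f x) ->
    forall t : nat, (0 < t)%N ->
      supp (A d f t) `<=`
      \bigcup_(s in [set s | (0 < s < t)%N]) supp (grad f (A d f s))].

(* Since the step sizes are left open, an accelerated gradient method for
   sigma-strongly convex functions with L-Lipschitz gradient is specified by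
   the classes it belongs to, its starting point and its guarantee. *)
Record is_AGD {R : realType} (sigma L : R) (A : algorithm R) : Prop := {
  AGD_zr : A_zr A;
  AGD_det : A_det A;
  AGD_start : forall (d : nat) (f : 'rV[R]_d.+1 -> R),
    (forall x, differentiable f x) -> A d f 1%N = 0;
  AGD_guarantee : forall (d : nat) (f : 'rV[R]_d.+1 -> R) (xstar : 'rV[R]_d.+1),
    strongly_convex sigma f -> lipschitz_gradient L f ->
    (forall y, f xstar <= f y) ->
    forall t : nat, (0 < t)%N ->
      f (A d f t) - f xstar
        <= (1 - Num.sqrt (sigma / L)) ^+ t.-1 * L * enorm xstar ^+ 2 /\
      f (A d f t) <= f 0
}.

Definition PAGD {R : realType} (AGD : R -> R -> algorithm R) (sigma L1 : R) :
    algorithm R :=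
  fun d f => AGD sigma (L1 + sigma) d (fun x => f x + sigma / 2 * enorm x ^+ 2).

(* Values in \bar R: +oo if the tolerance is never reached. *)
Definition T_eps {R : realType} (eps : R) (A : algorithm R) (d : nat)
    (f : 'rV[R]_d.+1 -> R) : \bar R :=
  ereal_inf [set t%:R%:E | t in
    [set t : nat | (0 < t)%N /\ enorm (grad f (A d f t)) <= eps]].

Definition sup_T_eps {R : realType} (eps : R) (A : algorithm R)
    (F : function_class R) : \bar R :=
  ereal_sup [set T | exists (d : nat) (f : 'rV[R]_d.+1 -> R),
    F d f /\ T = T_eps eps A f].

Definition complexity {R : realType} (eps : R) (AA : set (algorithm R))
    (F : function_class R) : \bar R :=
  ereal_inf [set sup_T_eps eps A F | A in AA].

Definition log_plus {R : realType} (x : R) : R := Num.max 0 (ln x).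

(* Main.v *)
Require Import Defs.
From mathcomp Require Import all_boot all_order all_algebra.
From mathcomp Require Import all_classical all_reals all_analysis.
From mathcomp Require Import measurable_realfun ring lra.
Import Order.TTheory GRing.Theory Num.Theory.
Import numFieldNormedType.Exports.
Local Open Scope classical_set_scope.
Local Open Scope ring_scope.

(** Write g = f + (sigma / 2) |.|^2, a = L1 Delta / eps^2, and let xs be the
    minimizer of g, which exists because f is bounded below and g is coercive.
    Then g is sigma-strongly convex with (L1 + sigma)-Lipschitz gradient, and
    its inverse condition number is sigma / (L1 + sigma) = 1 / (1 + 3 a).

    The gradient of f at an iterate z is compared with its gradient at xs:
      |grad f z|^2 <= 2 |grad f xs|^2 + 2 |grad f z - grad f xs|^2.
    Optimality of xs gives grad f xs = - sigma xs, while strong convexity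
    between xs and 0 gives sigma |xs|^2 <= Delta; so the first term is at most
    2 sigma Delta = (2 / 3) eps^2. By co-coercivity [sqr_grad_le_bregman] the
    second term is at most 4 L1 times the Bregman divergence of f, which is at
    most the gap g z - g xs [sqr_grad_le_regularized_gap]. The accelerated rate
    bounds that gap after N steps by
    (1 - (1 + 3 a)^(-1/2))^N (1 + 3 a) Delta, and the second term is at most
    eps^2 / 5 as soon as the power is at most 1 / (10 a)^2, provided a > 1 / 2.
    The numerical lemma [iteration_count] finds such an N below
    5 sqrt(a) ln(25 a): replacing 25 a by 10 a in the logarithm leaves room for
    rounding to an integer. When a <= 1 / 2, the starting point 0 already has
    |grad f 0|^2 <= 2 L1 Delta <= eps^2.

    Determinism of the proximal method [A_det_PAGD] holds because an answer of
    the oracle of f at a known point is converted measurably into the answer of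
    the oracle of g there, and the points themselves are, by strong induction,
    measurable functions of the earlier answers of f. *)

(** * Euclidean geometry of row vectors *)

Section euclidean_space.
Context {R : realType} {d : nat}.
Implicit Types (u v w x y : 'rV[R]_d.+1) (a b : R).

Lemma dotC u v : dot u v = dot v u.
Proof. by apply: eq_bigr => j _; rewrite mulrC. Qed.

Lemma dotDl u v w : dot (u + v) w = dot u w + dot v w.
Proof. by rewrite -big_split; apply: eq_bigr => j _; rewrite mxE mulrDl. Qed.

Lemma dotZl a u v : dot (a *: u) v = a * dot u v.
Proof. by rewrite mulr_sumr; apply: eq_bigr => j _; rewrite mxE mulrA. Qed.

Lemma dotNl u v : dot (- u) v = - dot u v.
Proof. by rewrite -scaleN1r dotZl mulN1r. Qed.

Lemma dotDr u v w : dot u (v + w) = dot u v + dot u w.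
Proof. by rewrite dotC dotDl !(dotC u). Qed.

Lemma dotZr a u v : dot u (a *: v) = a * dot u v.
Proof. by rewrite dotC dotZl dotC. Qed.

Lemma dotNr u v : dot u (- v) = - dot u v.
Proof. by rewrite dotC dotNl dotC. Qed.

Definition dotE := (dotDl, dotDr, dotNl, dotNr, dotZl, dotZr).

Lemma dot_ge0 u : 0 <= dot u u.
Proof. by apply: sumr_ge0 => j _; rewrite -expr2 sqr_ge0. Qed.

Lemma enorm_ge0 u : 0 <= enorm u.
Proof. exact: sqrtr_ge0. Qed.

Lemma sqr_enorm u : enorm u ^+ 2 = dot u u.
Proof. by rewrite sqr_sqrtr// dot_ge0. Qed.

Lemma enormZ a u : enorm (a *: u) = `|a| * enorm u.
Proof. by rewrite /enorm !dotE mulrA -expr2 sqrtrM ?sqr_ge0// sqrtr_sqr. Qed.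

Lemma enorm_eq0 u : enorm u = 0 -> u = 0.
Proof.
move=> u0; have := sqr_enorm u; rewrite u0 expr0n/= => /esym/eqP.
rewrite /dot psumr_eq0; last by move=> j _; rewrite -expr2 sqr_ge0.
move=> /allP u2; apply/rowP => j; rewrite mxE.
by have := u2 j (mem_index_enum j); rewrite mulf_eq0 orbb => /eqP.
Qed.

(** Cauchy-Schwarz. *)
Lemma dot_le_enorm u v : dot u v <= enorm u * enorm v.
Proof.
have [v0|v0] := eqVneq (enorm v) 0.
  by rewrite v0 mulr0 (enorm_eq0 v v0) /dot big1// => j _; rewrite mxE mulr0.
have [u0|u0] := eqVneq (enorm u) 0.
  by rewrite u0 mul0r (enorm_eq0 u u0) /dot big1// => j _; rewrite mxE mul0r.
have uv0 : 0 < enorm u * enorm v.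
  by rewrite mulr_gt0// lt_neqAle enorm_ge0 eq_sym ?u0 ?v0.
(* This square is 2 |u| |v| (|u| |v| - <u, v>). *)
have := dot_ge0 (enorm v *: u - enorm u *: v).
rewrite !dotE -!sqr_enorm (dotC v u); nra.
Qed.

Lemma enormD u v : enorm (u + v) <= enorm u + enorm v.
Proof.
rewrite -(@ler_pXn2r _ 2)// ?nnegrE ?addr_ge0 ?enorm_ge0//.
rewrite sqr_enorm !dotE (dotC v u) -!sqr_enorm.
have := dot_le_enorm u v; lra.
Qed.

Lemma coord_le_enorm u j : `|u 0 j| <= enorm u.
Proof.
rewrite -sqrtr_sqr ler_wsqrtr//.
rewrite /dot (bigD1 j)//= -expr2 lerDl sumr_ge0// => i _.
by rewrite -expr2 sqr_ge0.
Qed.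

Lemma norm_le_enorm u : `|u| <= enorm u.
Proof.
rewrite [leLHS]/Num.Def.normr/= mx_normrE; apply/bigmax_leP.
split; first exact: enorm_ge0.
by move=> [i j] _ /=; rewrite (ord1 i); exact: coord_le_enorm.
Qed.

Lemma sqr_enormD_le u v :
  enorm (u + v) ^+ 2 <= 2 * enorm u ^+ 2 + 2 * enorm v ^+ 2.
Proof.
have := dot_ge0 (u - v); rewrite !sqr_enorm !dotE (dotC v u); lra.
Qed.

End euclidean_space.

(** * Gradients *)

Section gradient.
Context {R : realType} {d : nat}.
Implicit Types (u v w x y : 'rV[R]_d.+1) (f : 'rV[R]_d.+1 -> R).

Lemma derive_grad f x v : differentiable f x -> 'D_v f x = dot (grad f x) v.
Proof.
move=> df; rewrite deriveE// {1}(row_sum_delta v) linear_sum.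
by apply: eq_bigr => j _; rewrite linearZ mxE deriveE// mulrC.
Qed.

(** The gradient is recognized from the directional derivatives. *)
Lemma grad_is_derive f x w : (forall v, is_derive x v f (dot w v)) ->
  grad f x = w.
Proof.
move=> df; apply/rowP => j; rewrite mxE derive_val.
rewrite /dot (bigD1 j)//= big1 ?mxE ?eqxx ?mulr1 ?addr0//.
by move=> i ij; rewrite mxE eqxx (negbTE ij) mulr0.
Qed.

Lemma is_derive_coord x v j : is_derive x v (fun y => y 0 j : R) (v 0 j).
Proof.
apply: DeriveDef; first exact/diff_derivable/differentiable_coord.
apply: cvg_lim => //; apply: cvg_near_cst; near=> h.
rewrite /= !mxE addrK [LHS]mulrA mulVf ?mul1r//.
by near: h; exact: nbhs_dnbhs_neq.
Unshelve. all: by end_near. Qed.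

Lemma is_derive_big (n : nat) (h : 'I_n -> 'rV[R]_d.+1 -> R) (dh : 'I_n -> R)
    x v : (forall j, is_derive x v (h j) (dh j)) ->
  is_derive x v (fun y => \sum_j h j y) (\sum_j dh j).
Proof.
move=> /is_derive_sum; congr is_derive.
by apply/funext => y; rewrite fct_sumE.
Qed.

Lemma is_derive_dot w x v : is_derive x v (dot w) (dot w v).
Proof.
apply: is_derive_big => j; have D := is_derive_coord x v j.
exact: (@is_deriveZ _ _ _ (fun y => y 0 j : R)).
Qed.

Lemma is_derive_sqr_enorm x v :
  is_derive x v (fun y : 'rV[R]_d.+1 => enorm y ^+ 2) (2 * dot x v).
Proof.
have -> : (fun y => enorm y ^+ 2) =
    (fun y => \sum_j ((fun z : 'rV[R]_d.+1 => z 0 j : R) ^+ 2) y).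
  by apply/funext => y; rewrite sqr_enorm; apply: eq_bigr => j _; rewrite -expr2.
rewrite /dot mulr_sumr; apply: is_derive_big => j.
have D := is_derive_coord x v j.
apply: is_derive_eq; rewrite /GRing.scale/=; ring.
Qed.

Lemma differentiable_sqr_enorm x :
  differentiable (fun y : 'rV[R]_d.+1 => enorm y ^+ 2) x.
Proof.
have -> : (fun y => enorm y ^+ 2) =
    \sum_(j < d.+1) ((fun y => y 0 j : R) ^+ 2) :> ('rV[R]_d.+1 -> R).
  apply/funext => y; rewrite sqr_enorm fct_sumE; apply: eq_bigr => j _.
  by rewrite -expr2.
apply: differentiable_sum => j.
exact/differentiableX/differentiable_coord.
Qed.

Lemma differentiable_dot w x : differentiable (dot w) x.
Proof.
have -> : dot w = \sum_(j < d.+1) (w 0 j \*: (fun y : 'rV[R]_d.+1 => y 0 j : R)).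
  by apply/funext => y; rewrite fct_sumE.
apply: differentiable_sum => j.
exact/differentiableZ/differentiable_coord.
Qed.

End gradient.

(** * Lipschitz gradients and convexity *)

Section smooth_and_convex.
Context {R : realType} {d : nat}.
Implicit Types (u v w x y : 'rV[R]_d.+1) (f : 'rV[R]_d.+1 -> R) (L sigma : R).

Lemma is_derive_line f x v (s : R) : differentiable f (x + s *: v) ->
  is_derive s 1 (fun t : R => f (x + t *: v)) (dot (grad f (x + s *: v)) v).
Proof.
move=> df; rewrite -derive_grad//.
(* The two difference quotients are the same function of the increment. *)
have E : (fun h : R => h^-1 *:
      (((fun t => f (x + t *: v)) \o shift s) (h *: 1) - f (x + s *: v))) =
    (fun h : R => h^-1 *: ((f \o shift (x + s *: v)) (h *: v) - f (x + s *: v))).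
  apply/funext => h /=; congr (_ *: (f _ - _)).
  by rewrite [h%:A]mulr1 scalerDl addrCA.
split; last by rewrite /derive E.
by have := @diff_derivable _ _ _ f _ v df; rewrite /derivable E.
Qed.

(** The descent lemma. *)
Lemma lipschitz_gradient_le_quadratic L f x v : lipschitz_gradient L f ->
  f (x + v) <= f x + dot (grad f x) v + L / 2 * enorm v ^+ 2.
Proof.
move=> [df lipf].
(* The mean value theorem is applied on [0, 1] to the difference between f and
   its quadratic bound along the segment. *)
pose c := dot (grad f x) v; pose q := L * enorm v ^+ 2.
pose p : R -> R := fun t : R => f (x + t *: v) - (t * c + q / 2 * t ^+ 2).
pose dp (t : R) : R := dot (grad f (x + t *: v)) v - (c + q * t).
have Dp (t : R) : is_derive t (1 : R) p (dp t).
  apply: is_deriveB; first exact: is_derive_line.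
  by apply: is_derive_eq; rewrite /GRing.scale/=; field.
have pc : {within `[0, 1], continuous p}.
  apply: continuous_subspaceT => z; apply: differentiable_continuous.
  by apply/derivable1_diffP; have := Dp z.
have [t t01 +] := @MVT R p dp 0 1 ltr01 (fun t _ => Dp t) pc.
have -> : p 0 = f x by rewrite /p scale0r addr0; ring.
have -> : p 1 = f (x + v) - (c + q / 2) by rewrite /p scale1r; ring.
rewrite subr0 mulr1 => Ep.
suff : dp t <= 0 by rewrite /c /q in Ep *; lra.
move: t01; rewrite in_itv/= => /andP[t0 t1].
have := dot_le_enorm (grad f (x + t *: v) - grad f x) v.
have := lipf (x + t *: v) x; rewrite addrAC subrr add0r enormZ gtr0_norm//.
rewrite /dp /c /q !dotE => H1 H2.
have := ler_wpM2r (enorm_ge0 v) H1; lra.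
Qed.

(** A function bounded below cannot be steep: a step of length |grad f x| / L
    against the gradient decreases it by at least |grad f x|^2 / (2 L). *)
Lemma sqr_grad_le_gap L f m x : 0 < L -> lipschitz_gradient L f ->
  (forall y, m <= f y) -> enorm (grad f x) ^+ 2 <= 2 * L * (f x - m).
Proof.
move=> L0 lipf lef.
have := lipschitz_gradient_le_quadratic L f x (- L^-1 *: grad f x) lipf.
rewrite enormZ dotZr -sqr_enorm exprMn real_normK ?num_real// sqrrN.
have := lef (x - L^-1 *: grad f x); rewrite -scaleNr.
set g := enorm _ ^+ 2 => H1 H2.
have H3 : L / 2 * (L^-1 ^+ 2 * g) = L^-1 * g / 2 by field; rewrite gt_eqF.
have : L^-1 * g <= 2 * (f x - m) by lra.
by rewrite ler_pdivrMl// mulrA (mulrC L).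
Qed.

(** A convex function lies above its tangent hyperplanes: the difference quotient
    from x towards y is at most f y - f x for every step in (0, 1]. *)
Lemma convex_above_tangent f x y : convex_function setT f ->
  differentiable f x -> f x + dot (grad f x) (y - x) <= f y.
Proof.
move=> cf df; rewrite addrC -lerBrDr -derive_grad//.
set v := y - x; pose q (h : R) := h^-1 *: ((f \o shift x) (h *: v) - f x).
have cq : q h @[h --> 0^'+] --> 'D_v f x.
  apply: cvg_dnbhs_at_right; exact: (@diff_derivable _ _ _ f _ v df).
rewrite -(cvg_lim _ cq)//; apply: limr_le; first exact: cvgP cq.
near=> h.
have h0 : 0 < h by near: h; exact: nbhs_right_gt.
have h1 : h <= 1 by near: h; apply: nbhs_right_le.
rewrite /q /= /GRing.scale/= ler_pdivrMl//.
have := cf (Itv01 (ltW h0) h1) y x; rewrite !inE => /(_ I I).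
have -> : conv (Itv01 (ltW h0) h1) (y : convex_lmodType _)
    (x : convex_lmodType _) = h *: v + x :> 'rV[R]_d.+1.
  by apply/rowP => i; rewrite /conv/= /unstable.onem !mxE; ring.
rewrite convRE/= /unstable.onem; lra.
Unshelve. all: by end_near. Qed.

End smooth_and_convex.

(** * The proximal regularization *)

(** The function f + (sigma / 2) |.|^2 to which the proximal method applies
    accelerated gradient descent. *)
Definition regularized {R : realType} {d : nat} (sigma : R)
    (f : 'rV[R]_d.+1 -> R) : 'rV[R]_d.+1 -> R :=
  fun x => f x + sigma / 2 * enorm x ^+ 2.

Section regularization.
Context {R : realType} {d : nat}.
Implicit Types (u v w x y : 'rV[R]_d.+1) (f : 'rV[R]_d.+1 -> R) (L sigma : R).

Lemma differentiable_regularized sigma f x : differentiable f x ->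
  differentiable (regularized sigma f) x.
Proof.
move=> df; apply: differentiableD => //.
exact/(@differentiableZ _ _ _ (fun y => enorm y ^+ 2))/differentiable_sqr_enorm.
Qed.

Lemma grad_regularized sigma f x : differentiable f x ->
  grad (regularized sigma f) x = grad f x + sigma *: x.
Proof.
move=> df; apply: grad_is_derive => v; rewrite dotDl -derive_grad//.
apply: is_deriveD; first exact/derivableP/diff_derivable.
have := is_derive_sqr_enorm x v => D.
have := @is_deriveZ _ _ _ (fun y => enorm y ^+ 2) (sigma / 2) x v _ D.
by congr is_derive; rewrite dotZl /GRing.scale/=; field.
Qed.

Lemma strongly_convex_regularized sigma f : convex_function setT f ->
  (forall x, differentiable f x) -> strongly_convex sigma (regularized sigma f).
Proof.
move=> cf df x y; rewrite grad_regularized// /regularized.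
have := convex_above_tangent f x y cf (df x).
rewrite !sqr_enorm !dotE (dotC y x); lra.
Qed.

Lemma lipschitz_gradient_regularized L sigma f : 0 <= sigma ->
  lipschitz_gradient L f -> lipschitz_gradient (L + sigma) (regularized sigma f).
Proof.
move=> s0 [df lipf]; split=> [x|x y]; first exact: differentiable_regularized.
rewrite !grad_regularized// opprD addrACA -scalerBr mulrDl.
apply: le_trans (enormD _ _) _; rewrite enormZ ger0_norm// lerD2r; exact: lipf.
Qed.

(** The sublevel set of level f 0 is nonempty, and it is compact since f is bounded
    below: the minimum over it is global. *)
Lemma regularized_minimizer sigma f m : 0 < sigma ->
  (forall x, differentiable f x) -> (forall x, m <= f x) ->
  exists x0, forall x, regularized sigma f x0 <= regularized sigma f x.
Proof.
move=> s0 df lef; set g := regularized sigma f.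
have gc : continuous g.
  by move=> x; exact/differentiable_continuous/differentiable_regularized.
pose A := [set x | g x <= f 0].
have g0 : g 0 = f 0.
  rewrite /g /regularized sqr_enorm /dot big1 ?mulr0 ?addr0// => j _.
  by rewrite mxE mul0r.
have Ac : compact A.
  apply: bounded_closed_compact; last first.
    by apply: preimage_closed (@closed_le R (f 0)) => x _; exact: gc.
  have gap x : A x -> enorm x ^+ 2 <= 2 * (f 0 - m) / sigma.
    rewrite /A /= /g /regularized => H; have := lef x => Hm.
    rewrite ler_pdivlMr//; lra.
  exists (Num.sqrt (2 * (f 0 - m) / sigma)); split=> [|M /ltW rM x /gap H].
    exact: num_real.
  apply: le_trans (norm_le_enorm x) (le_trans _ rM).
  by rewrite -(ger0_norm (enorm_ge0 x)) -sqrtr_sqr ler_wsqrtr.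
have [x0 x0A x0min] : exists2 c, c \in A & forall t, t \in A -> g c <= g t.
  apply: EVT_min_rV Ac _; first by exists 0; rewrite /A /= g0.
  exact: continuous_subspaceT.
exists x0 => x; have [xA|xA] := leP (g x) (f 0); first by apply: x0min; rewrite inE.
by apply: le_trans (ltW xA); rewrite inE in x0A.
Qed.

End regularization.

(** * The number of iterations *)

Section number_of_iterations.
Context {R : realType}.

(** With a = L1 Delta / eps^2, the accelerated contraction factor being
    1 - (1 + 3 a)^(-1/2), some number N <= 5 sqrt(a) ln(25 a) of steps reduces
    the gap by the factor 1 / (10 a)^2. Indeed N >= 5 sqrt(a) ln(10 a) suffices,
    and 5 sqrt(a) ln(25 / 10) > 1 leaves room for an integer. *)
Lemma iteration_count (a : R) : 1 / 2 < a ->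
  exists N : nat, N%:R <= 5 * Num.sqrt a * ln (25 * a) /\
    (1 - Num.sqrt (1 + 3 * a)^-1) ^+ N * (10 * a) ^+ 2 <= 1.
Proof.
move=> a12; set k := Num.sqrt (1 + 3 * a)^-1; set s := Num.sqrt a.
have a10 : 1 < 10 * a by lra.
have b0 : 0 < ln (10 * a) by exact: ln_gt0.
have s0 : 0 <= s by exact: sqrtr_ge0.
have sE : s ^+ 2 = a by rewrite sqr_sqrtr//; lra.
have s7 : 7 / 10 <= s by nra.
have q0 : 0 < 1 + 3 * a by lra.
have kE : k ^+ 2 = (1 + 3 * a)^-1 by rewrite sqr_sqrtr// invr_ge0 ltW.
have k0 : 0 <= k by exact: sqrtr_ge0.
have kE' : k ^+ 2 * (1 + 3 * a) = 1 by rewrite kE mulVf// gt_eqF.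
have k1 : k <= 1 by nra.
have ks : 2 <= 5 * s * k.
  have : 2 ^+ 2 <= (5 * s * k) ^+ 2.
    have a21 : 0 <= 2 * a - 1 by lra.
    by rewrite !exprMn sE; have := mulr_ge0 (sqr_ge0 k) a21; lra.
  by rewrite ler_sqr ?nnegrE//; nra.
(* From ln (2 / 5) <= 2 / 5 - 1. *)
have l52 : 3 / 5 <= ln (5 / 2 : R).
  have := @le_ln1Dx R (- (3 / 5)).
  rewrite (_ : 1 + - (3 / 5) = (5 / 2)^-1); last by field.
  by rewrite lnV ?posrE//; lra.
have lE : ln (25 * a) = ln (10 * a) + ln (5 / 2).
  by rewrite -lnM ?posrE//; [congr ln; field|lra].
have X0 : 0 <= 5 * s * ln (25 * a) by rewrite lE; nra.
exists (Num.truncn (5 * s * ln (25 * a))).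
have /andP[NX XN] := truncn_itv X0; split=> //.
move: XN; set N := Num.truncn _; rewrite -natr1 lE => XN.
have bN : 5 * s * ln (10 * a) <= N%:R by nra.
have bkN : 2 * ln (10 * a) <= k * N%:R.
  apply: le_trans (ler_wpM2l k0 bN); nra.
have r1 : (1 - k) ^+ N <= expR (- (2 * ln (10 * a))).
  apply: (@le_trans _ _ (expR (- k) ^+ N)).
    by rewrite lerXn2r ?nnegrE ?expR_ge0 ?subr_ge0// expR_ge1Dx.
  by rewrite -expRM_natr ler_expR mulNr lerN2.
apply: le_trans (ler_wpM2r (sqr_ge0 _) r1) _.
have a0 : 0 < 10 * a by exact: lt_trans ltr01 a10.
have a20 : (10 * a) ^+ 2 != 0 by rewrite expf_neq0 ?gt_eqF.
by rewrite expRN expRM_natl lnK ?posrE ?a0// mulVf.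
Qed.

End number_of_iterations.

(** * Gradient of f and suboptimality of the regularization *)

Section gradient_bound.
Context {R : realType} {d : nat}.
Implicit Types (f : 'rV[R]_d.+1 -> R) (x y z : 'rV[R]_d.+1) (L sigma Delta : R).

(** The infimum of f over the extended reals turned into pointwise bounds. *)
Lemma F_conv_gap Delta L f y : F_conv Delta L f -> f 0 - f y <= Delta.
Proof.
move=> [_ _ _]; rewrite -lee_fin; apply: le_trans.
rewrite EFinB; apply: leeB => //; apply: ereal_inf_lbound; exists y => //.
Qed.

(** Strong convexity between the critical point xstar and 0 gives
    f 0 >= f xstar + sigma |xstar|^2. *)
Lemma regularized_minimizer_bound Delta sigma f xstar :
  convex_function setT f -> (forall x, differentiable f x) ->
  (forall y, f 0 - f y <= Delta) ->
  grad (regularized sigma f) xstar = 0 ->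
  sigma * enorm xstar ^+ 2 <= Delta.
Proof.
move=> cf df gap g0.
have := strongly_convex_regularized sigma f cf df xstar 0.
rewrite g0 /regularized sub0r -scaleN1r enormZ normrN1 mul1r.
have -> : dot (0 : 'rV[R]_d.+1) (-1 *: xstar) = 0.
  by rewrite /dot big1// => j _; rewrite mxE mul0r.
have -> : enorm (0 : 'rV[R]_d.+1) = 0 by rewrite -(scale0r 0) enormZ normr0 mul0r.
by have := gap xstar; rewrite expr0n/=; lra.
Qed.

(** Co-coercivity: the bound of the squared gradient by the gap, for the function
    f - dot (grad f x), which is minimal at x by convexity. *)
Lemma sqr_grad_le_bregman L f x y : 0 < L -> convex_function setT f ->
  lipschitz_gradient L f ->
  enorm (grad f y - grad f x) ^+ 2 <=
    2 * L * (f y - f x - dot (grad f x) (y - x)).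
Proof.
move=> L0 cf [df lipf]; pose h z := f z - dot (grad f x) z.
have dh z : differentiable h z.
  apply: differentiableB => //; exact: differentiable_dot.
have gh z : grad h z = grad f z - grad f x.
  apply: grad_is_derive => v; rewrite dotDl dotNl -derive_grad//.
  apply: is_deriveB; first exact/derivableP/diff_derivable.
  exact: is_derive_dot.
have lh : lipschitz_gradient L h.
  by split=> [|u v]; [exact: dh|rewrite !gh opprB addrA subrK; exact: lipf].
have hx z : h x <= h z.
  by have := convex_above_tangent f x z cf (df x); rewrite /h dotDr dotNr; lra.
by have := sqr_grad_le_gap L h (h x) y L0 lh hx; rewrite gh /h dotDr dotNr; lra.
Qed.

(** The squared gradient of f at z in terms of the gap of the regularized function
    at z; the splitting is by comparison with the gradient at the minimizer. *)
Lemma sqr_grad_le_regularized_gap Delta L sigma f xstar z :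
  0 < L -> 0 < sigma -> convex_function setT f -> lipschitz_gradient L f ->
  (forall y, f 0 - f y <= Delta) ->
  (forall y, regularized sigma f xstar <= regularized sigma f y) ->
  sigma * enorm xstar ^+ 2 <= Delta /\
  enorm (grad f z) ^+ 2 <= 2 * sigma * Delta +
    4 * L * (regularized sigma f z - regularized sigma f xstar).
Proof.
move=> L0 s0 cf lipf gap minx; have df := lipf.1.
have g0 : grad (regularized sigma f) xstar = 0.
  apply: enorm_eq0; apply/eqP; rewrite -sqrf_eq0 eq_le sqr_ge0 andbT.
  have Ls0 : 0 < L + sigma by rewrite addr_gt0.
  have lg := lipschitz_gradient_regularized L sigma f (ltW s0) lipf.
  have := sqr_grad_le_gap (L + sigma) _ _ xstar Ls0 lg minx.
  by rewrite subrr mulr0.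
have bx := regularized_minimizer_bound Delta sigma f xstar cf df gap g0.
split=> //.
have gx : grad f xstar = - (sigma *: xstar).
  by apply/eqP; rewrite -addr_eq0 -grad_regularized// g0.
have := sqr_enormD_le (grad f xstar) (grad f z - grad f xstar).
rewrite addrC subrK gx -scaleNr enormZ normrN gtr0_norm// exprMn.
have := sqr_grad_le_bregman L f xstar z L0 cf lipf.
rewrite gx -scaleNr /regularized.
(* Since grad f xstar = - sigma *: xstar, the gap of the regularized function is
   the Bregman divergence of f between z and xstar plus
   (sigma / 2) |z - xstar|^2. *)
have H := mulr_ge0 (ltW (mulr_gt0 L0 s0)) (dot_ge0 (z - xstar)).
have := ler_wpM2l (ltW s0) bx; move: H.
rewrite !sqr_enorm !dotE (dotC xstar z); lra.
Qed.

End gradient_bound.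

(** * Determinism of the proximal method *)

Section determinism.
Context {R : realType}.

Section measurability.
Context {disp : measure_display} {T : measurableType disp} {d : nat}.
Implicit Types (u v : T -> borel_rV R d).

(** A map into R^d is measurable when its coordinates are. *)
Lemma measurable_rV u :
  (forall j, measurable_fun setT (fun t => u t 0 j : measurableTypeR R)) ->
  measurable_fun setT u.
Proof.
move=> mu; apply: (@measurability _ _ _ (borel_rV R d) setT u (@cylinders R d)) => //.
move=> _ [_ [j [B [mB ->]]] <-]; exact: (mu j measurableT B mB).
Qed.

Lemma measurable_coord u j : measurable_fun setT u ->
  measurable_fun setT (fun t => u t 0 j : measurableTypeR R).
Proof.
move=> mu _ B mB; apply: (mu measurableT [set v | B (v 0 j)]).
by apply: sub_sigma_algebra; exists j, B.
Qed.

Lemma measurable_rVDZ (sigma : R) u v : measurable_fun setT u ->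
  measurable_fun setT v ->
  measurable_fun setT (fun t =>
    (u t : 'rV[R]_d.+1) + sigma *: (v t : 'rV[R]_d.+1) : borel_rV R d).
Proof.
move=> mu mv; apply: measurable_rV => j.
have := measurable_funD (measurable_coord u j mu)
  (measurable_funM (measurable_cst sigma) (measurable_coord v j mv)).
by apply: eq_measurable_fun => t _ /=; rewrite !mxE.
Qed.

Lemma measurable_sqr_enorm u : measurable_fun setT u ->
  measurable_fun setT (fun t => enorm (u t) ^+ 2 : measurableTypeR R).
Proof.
move=> mu; pose F (j : 'I_d.+1) t := (u t 0 j * u t 0 j : measurableTypeR R).
have mF j : measurable_fun setT (F j).
  by apply: measurable_funM; exact: measurable_coord.
have := measurable_sum (index_enum 'I_d.+1) mF.
by apply: eq_measurable_fun => t _ /=; rewrite sqr_enorm.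
Qed.

End measurability.

(** Running a deterministic method on the regularized function is again a
    deterministic method on f. *)
Lemma A_det_PAGD (AGD : R -> R -> algorithm R) (sigma L1 : R) :
  A_det (AGD sigma (L1 + sigma)) -> A_det (PAGD AGD sigma L1).
Proof.
move=> detA d; have [B [mB AB]] := detA d.
set P := PAGD AGD sigma L1.
(* For each t separately, the iterate number t.+1 is a measurable function of the
   first t answers; strong induction on t. *)
have step t : exists Ai : t.-tuple (oracle_answer R d) -> borel_rV R d,
    measurable_fun setT Ai /\
    (forall f : 'rV[R]_d.+1 -> R, (forall x, differentiable f x) ->
      P d f t.+1 = Ai (history f (P d f) t)).
  elim/ltn_ind: t => t IH.
  have {}IH (s : 'I_t) := IH s (ltn_ord s).
  pose X (s : 'I_t) : s.-tuple (oracle_answer R d) -> borel_rV R d :=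
    projT1 (cid (IH s)).
  have mX s : measurable_fun setT (X s) := (projT2 (cid (IH s))).1.
  have XP (s : 'I_t) f : (forall x, differentiable f x) ->
      P d f s.+1 = X s (history f (P d f) s) := (projT2 (cid (IH s))).2 f.
  (* The point number s.+1 only depends on the first s answers. *)
  pose prefix (s : 'I_t) (h : t.-tuple (oracle_answer R d)) :
      s.-tuple (oracle_answer R d) :=
    [tuple tnth h (widen_ord (ltnW (ltn_ord s)) i) | i < s].
  have mprefix s : measurable_fun setT (prefix s).
    apply/measurable_fun_tnthP => i.
    have := @measurable_tnth _ (oracle_answer R d) t (widen_ord (ltnW (ltn_ord s)) i).
    by apply: eq_measurable_fun => h _ /=; rewrite tnth_mktuple.
  have prefixP s f x : prefix s (history f x t) = history f x s.
    by apply: eq_from_tnth => i; rewrite /prefix /history !tnth_mktuple.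
  (* The answer of the oracle of the regularized function, from the answer of
     that of f at the same point. *)
  pose answer (h : t.-tuple (oracle_answer R d)) (s : 'I_t) : oracle_answer R d :=
    let x : 'rV[R]_d.+1 := X s (prefix s h) in
    ((tnth h s).1 + sigma / 2 * enorm x ^+ 2, ((tnth h s).2 : 'rV[R]_d.+1) + sigma *: x).
  pose convert h := [tuple answer h s | s < t].
  exists (B t \o convert); split.
    apply: measurableT_comp; first exact: mB.
    apply/measurable_fun_tnthP => s.
    have mx : measurable_fun setT (X s \o prefix s).
      exact: measurableT_comp (mX s) (mprefix s).
    have mh := @measurable_tnth _ (oracle_answer R d) t s.
    have m1 := measurableT_comp measurable_fst mh.
    have m2 := measurableT_comp measurable_snd mh.
    have m3 := measurable_funD m1
      (measurable_funM (measurable_cst (sigma / 2)) (measurable_sqr_enorm _ mx)).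
    have := measurable_fun_pair m3 (measurable_rVDZ sigma _ _ m2 mx).
    by apply: eq_measurable_fun => h _ /=; rewrite tnth_mktuple.
  move=> f df /=; rewrite /P /PAGD AB.
    congr (B t _); apply: eq_from_tnth => s; rewrite /convert /history !tnth_mktuple.
    rewrite /answer prefixP /history tnth_mktuple -XP//=; congr pair.
    by rewrite -grad_regularized.
  by move=> x; exact: differentiable_regularized.
exists (fun t => projT1 (cid (step t))); split=> [t|f df t].
  exact: (projT2 (cid (step t))).1.
exact: (projT2 (cid (step t))).2.
Qed.

End determinism.

(** * Rate of convergence *)

Section rate.
Context {R : realType} (Delta L1 eps : R)
  (Delta0 : 0 < Delta) (L0 : 0 < L1) (eps0 : 0 < eps).
Let sigma := eps ^+ 2 / (3 * Delta).
Let a := L1 * Delta / eps ^+ 2.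

Let sigma_gt0 : 0 < sigma.
Proof. by rewrite divr_gt0 ?mulr_gt0 ?exprn_gt0. Qed.

Let a_gt0 : 0 < a.
Proof. by rewrite divr_gt0 ?mulr_gt0 ?exprn_gt0. Qed.

Let L1sigma : L1 + sigma = (1 + 3 * a) * sigma.
Proof. by rewrite /a /sigma; field; rewrite !gt_eqF. Qed.

Let sigmaDelta : sigma * Delta = eps ^+ 2 / 3.
Proof. by rewrite /sigma; field; rewrite !gt_eqF. Qed.

Let L1Delta : L1 * Delta = a * eps ^+ 2.
Proof. by rewrite /a; field; rewrite !gt_eqF. Qed.

Let condition_number : sigma / (L1 + sigma) = (1 + 3 * a)^-1.
Proof.
have q0 : 1 + 3 * a != 0 by rewrite gt_eqF// addr_gt0// mulr_gt0.
by rewrite L1sigma invfM mulrCA divff ?mulr1// gt_eqF.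
Qed.

(** The stopping criterion holds at an iterate N.+1 within the stated bound. *)
Lemma PAGD_stops (AGD : R -> R -> algorithm R) (d : nat)
    (f : 'rV[R]_d.+1 -> R) :
  is_AGD sigma (L1 + sigma) (AGD sigma (L1 + sigma)) -> F_conv Delta L1 f ->
  exists N : nat,
    enorm (grad f (PAGD AGD sigma L1 f N.+1)) <= eps /\
    N%:R <= 5 * Num.sqrt a * log_plus (25 * a).
Proof.
move=> [_ _ start guarantee] Ff.
have gap y := F_conv_gap Delta L1 f y Ff.
have lef y : f 0 - Delta <= f y by have := gap y; lra.
have [_ cf lipf _] := Ff; have df := lipf.1.
have small x : enorm (grad f x) ^+ 2 <= eps ^+ 2 -> enorm (grad f x) <= eps.
  by rewrite ler_sqr ?nnegrE ?enorm_ge0 ?(ltW eps0).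
have [a12|a12] := leP a (1 / 2).
  (* The starting point 0 is already stationary enough. *)
  exists 0; split; last first.
    by rewrite !mulr_ge0 ?sqrtr_ge0// /log_plus le_max lexx.
  rewrite /PAGD start; last by move=> x; exact: differentiable_regularized.
  apply: small.
  apply: le_trans (sqr_grad_le_gap L1 f (f 0 - Delta) 0 L0 lipf lef) _.
  rewrite subKr -mulrA L1Delta mulrA.
  have := ler_wpM2r (sqr_ge0 eps) a12; lra.
have [N [NX rN]] := iteration_count a a12.
exists N; split; last first.
  apply: le_trans NX _; rewrite ler_wpM2l ?mulr_ge0 ?sqrtr_ge0//.
  by rewrite /log_plus le_max lexx orbT.
apply: small.
have [xs minx] := regularized_minimizer sigma f (f 0 - Delta) sigma_gt0 df lef.
set z := PAGD _ _ _ _ _.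
have [bx bz] := sqr_grad_le_regularized_gap Delta L1 sigma f xs z L0 sigma_gt0
  cf lipf gap minx.
have [+ _] := guarantee d _ xs (strongly_convex_regularized sigma f cf df)
  (lipschitz_gradient_regularized L1 sigma f (ltW sigma_gt0) lipf) minx N.+1 isT.
rewrite /= condition_number -/z; set r := (_ - _) ^+ N in rN * => gapz.
have r0 : 0 <= r.
  rewrite exprn_ge0// subr_ge0 -[leRHS]sqrtr1 ler_wsqrtr// invf_le1; last by lra.
  by lra.
have gapz' : regularized sigma f z - regularized sigma f xs <=
    r * (1 + 3 * a) * Delta.
  apply: le_trans gapz _.
  rewrite L1sigma (mulrA r) -(mulrA (r * _)) ler_wpM2l// mulr_ge0//; lra.
(* Since 1 <= 2 a, the factor 1 + 3 a is at most 5 a. *)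
have ra : r * (1 + 3 * a) * a <= 1 / 20.
  have a21 : 0 <= 2 * a - 1 by lra.
  have := mulr_ge0 r0 (mulr_ge0 (ltW a_gt0) a21); lra.
have := ler_wpM2l (ltW L0) gapz'; have := ler_wpM2r (sqr_ge0 eps) ra.
have -> : L1 * (r * (1 + 3 * a) * Delta) = r * (1 + 3 * a) * a * eps ^+ 2.
  by rewrite -[RHS]mulrA -L1Delta; ring.
have := sigmaDelta; have := sqr_ge0 eps; lra.
Qed.


End rate.

Theorem proposition2 (R : realType) (Delta L1 eps : R)
    (hDelta : 0 < Delta) (hL1 : 0 < L1) (heps : 0 < eps)
    (AGD : R -> R -> algorithm R)
    (hAGD : forall sigma L : R,
       0 < sigma -> sigma <= L -> is_AGD sigma L (AGD sigma L)) :
  let sigma := eps ^+ 2 / (3 * Delta) in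
  [/\ A_det (PAGD AGD sigma L1),
      (complexity eps A_det (F_conv Delta L1)
        <= sup_T_eps eps (PAGD AGD sigma L1) (F_conv Delta L1))%E &
      (sup_T_eps eps (PAGD AGD sigma L1) (F_conv Delta L1)
        <= (1 + 5 * (Num.sqrt (L1 * Delta) / eps)
              * log_plus (25 * L1 * Delta / eps ^+ 2))%:E)%E].
Proof.
move=> sigma.
have sigma0 : 0 < sigma by rewrite divr_gt0 ?mulr_gt0 ?exprn_gt0.
have agd : is_AGD sigma (L1 + sigma) (AGD sigma (L1 + sigma)).
  by apply: hAGD; rewrite // lerDr ltW.
have det : A_det (PAGD AGD sigma L1) by apply: A_det_PAGD; exact: AGD_det agd.
split=> //; first by apply: ereal_inf_lbound; exists (PAGD AGD sigma L1).
apply: ge_ereal_sup => _ [d [f [Ff ->]]].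
have [N [gN NX]] := PAGD_stops Delta L1 eps hDelta hL1 heps AGD d f agd Ff.
apply: (@le_trans _ _ N.+1%:R%:E).
  by apply: ereal_inf_lbound; exists N.+1.
rewrite lee_fin -natr1 addrC lerD2l; apply: le_trans NX _.
have LD0 : 0 <= L1 * Delta by rewrite mulr_ge0 ?ltW.
have -> : Num.sqrt (L1 * Delta / eps ^+ 2) = Num.sqrt (L1 * Delta) / eps.
  by rewrite (sqrtrM _ LD0) sqrtrV ?sqr_ge0// sqrtr_sqr gtr0_norm.
by rewrite -(mulrA 25 L1) -(mulrA 25 (L1 * Delta)).
Qed.
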